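(* There is a constant $c>0$ such that $\tau(d)\ge (cd)^{d/2}$ for all $d$ that are powers of $2$.
   Context: For an integer $d\ge1$, a sequence $v_1,\dots,v_t$ ($t\ge 2$) of vectors in $[-1,1]^d$ is called minimal if (i) $v_1+\dots+v_t\in[-1,1]^d$, and (ii) for every index set $S\subset\{1,\dots,t\}$ with $2\le |S|<t$, the sum $\sum_{i\in S}v_i$ lies outside $[-1,1]^d$. Let $\tau(d)$ denote the largest $t$ for which a minimal sequence of length $t$ in $[-1,1]^d$ exists. *)

(* Defs.v *)
From HB Require Import structures.
From mathcomp Require Import all_boot all_order all_algebra.
From mathcomp Require Import reals.
Set Implicit Arguments. Unset Strict Implicit. Unset Printing Implicit Defensive.
Import Order.TTheory GRing.Theory Num.Theory.
Local Open Scope ring_scope.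

Definition in_cube (R : realType) (d : nat) (x : 'rV[R]_d) : Prop :=
  forall i : 'I_d, `|x 0 i| <= 1.

Definition minimal_seq (R : realType) (d t : nat) (v : 'I_t -> 'rV[R]_d) : Prop :=
  (2 <= t)%N /\
  (forall i, in_cube (v i)) /\
  in_cube (\sum_(i < t) v i) /\
  (forall S : {set 'I_t}, (2 <= #|S|)%N -> (#|S| < t)%N ->
     ~ in_cube (\sum_(i in S) v i)).

(* Main.v *)
(* Subsets of 'I_m index both the d = 2 ^ m coordinates and the d columns of a sign
   matrix; row A is the Walsh character chi A on the subcube of those x that are disjoint
   from core A, and minus an earlier character off it. This is a variant of the
   ill-conditioned matrices of Hastad and Alon-Vu. The crucial change is that core A has
   size |A| - 2 instead of |A| - 1, which makes the lattice spanned by the columns sparse: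
   its only points in the cube are 0 and the columns up to sign. On the other hand there is
   an integer vector n whose row sums n.A all lie in {0, 2, -2}, and its Walsh coefficients
   grow by a factor of at least 2 ^ (|A| - 3) at every step of a walk through all sets of
   size at least 6, hence up to (d / 2 ^ 12) ^ (d / 2). The sequence consists of |n x|
   copies of each column x with the sign of n x, together with one further vector, the
   driver, which brings the total back to the cube. Modulo 4 arguments show that no other
   combination does so. *)

Require Import Defs.
From HB Require Import structures.
From mathcomp Require Import all_boot all_order all_algebra.
From mathcomp Require Import reals.
From mathcomp Require Import zify.
Set Implicit Arguments. Unset Strict Implicit. Unset Printing Implicit Defensive.
Import Order.TTheory GRing.Theory Num.Theory.
Local Open Scope ring_scope.

(** * Characters on subsets and Walsh coefficients *)

Definition chi m (A x : {set 'I_m}) : int := (-1) ^+ #|A :&: x|.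

Lemma chi_cases m (A x : {set 'I_m}) : chi A x = 1 \/ chi A x = -1.
Proof. by rewrite /chi -signr_odd; case: odd; [right | left]; rewrite ?expr1 ?expr0. Qed.

Lemma chi_set0l m (x : {set 'I_m}) : chi set0 x = 1.
Proof. by rewrite /chi set0I cards0. Qed.

Lemma chi_set0r m (A : {set 'I_m}) : chi A set0 = 1.
Proof. by rewrite /chi setI0 cards0. Qed.

Lemma chi_set1r m (A : {set 'I_m}) a : chi A [set a] = if a \in A then -1 else 1.
Proof.
rewrite /chi; case: ifP => aA.
  by rewrite (setIidPr _) ?sub1set // cards1.
rewrite [A :&: _](_ : _ = set0) ?cards0 //.
by apply/setP => b; rewrite !inE; case: eqP => [->|]; rewrite ?aA ?andbF.
Qed.

Lemma chi_set1l m a (x : {set 'I_m}) : chi [set a] x = if a \in x then -1 else 1.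
Proof. by rewrite -chi_set1r /chi setIC. Qed.

Lemma chiD m (A B x : {set 'I_m}) : B \subset A -> chi (A :\: B) x = chi A x * chi B x.
Proof.
move=> sBA; rewrite /chi -exprD -(cardsID B (A :&: x)).
rewrite [A :&: x :&: B](_ : _ = B :&: x); last first.
  by rewrite setIAC (setIidPr sBA).
rewrite setIDAC [in RHS]addnC addnA exprD -[in RHS]signr_odd.
by rewrite addnn odd_double expr0 mul1r.
Qed.

(** The sum factors over the elements of [A]: one outside [x] gives the factor 2, one inside [x] the
    factor 0. *)
Lemma sum_chi m (A x : {set 'I_m}) :
  \sum_(B : {set 'I_m} | B \subset A) chi B x = if [disjoint A & x] then 2 ^+ #|A| else 0.
Proof.
pose f (i : 'I_m) : int := if i \in A then (if i \in x then -1 else 1) else 0.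
have -> : \sum_(B : {set 'I_m} | B \subset A) chi B x = \prod_i (f i + 1).
  rewrite bigA_distr [RHS](bigID (fun B : {set 'I_m} => B \subset A)) /=.
  rewrite [X in _ = _ + X]big1 ?addr0 => [|B /subsetPn[i iB iA]]; last first.
    by rewrite (bigD1 i) //= iB /f (negbTE iA) mul0r.
  apply: eq_bigr => B sBA; rewrite -big_mkcond /= /chi -prodr_const.
  rewrite [RHS](bigID (mem x)) /= [X in _ = _ * X]big1 ?mulr1.
    apply: eq_big => i; first by rewrite inE.
    by rewrite inE => /andP[iB ix]; rewrite /f (subsetP sBA) // ix.
  by move=> i /andP[iB ix]; rewrite /f (subsetP sBA) // (negbTE ix).
case: ifP => [dis | /negbT].
  rewrite -prodr_const [RHS]big_mkcond; apply: eq_bigr => i _; rewrite /f.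
  by case: ifP => // iA; rewrite (disjointFr dis iA).
case/pred0Pn=> i /andP[iA ix].
by rewrite (bigD1 i) //= /f (iA : i \in A) (ix : i \in x) addNr mul0r.
Qed.

Definition walsh m (A : {set 'I_m}) (n : {set 'I_m} -> int) : int :=
  \sum_x chi A x * n x.

Lemma sum_walsh m (A : {set 'I_m}) n :
  \sum_(B : {set 'I_m} | B \subset A) walsh B n =
  2 ^+ #|A| * \sum_(x : {set 'I_m} | [disjoint A & x]) n x.
Proof.
rewrite exchange_big mulr_sumr [RHS]big_mkcond; apply: eq_bigr => x _.
by rewrite -mulr_suml sum_chi; case: ifP; rewrite ?mul0r.
Qed.

(** Strong induction on [#|x|]: [sum_walsh] at the complement of [x] yields a vanishing sum over the
    subsets of [x], of which only [x] itself is not settled yet. *)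
Lemma walsh_eq0 m n : (forall A : {set 'I_m}, walsh A n = 0) -> forall x, n x = 0.
Proof.
move=> z0 x; have [k le_xk] := ubnP #|x|; elim: k => // k IHk in x le_xk *.
have /eqP := sum_walsh (~: x) n.
rewrite big1 => [|? _]; last exact: z0.
rewrite eq_sym mulf_eq0 expf_eq0 andbF /= (bigD1 x) /=; last first.
  by rewrite disjoint_sym disjoints_subset setCK.
rewrite big1 ?addr0 => [/eqP // | y /andP[dxy nyx]].
apply: IHk; rewrite -ltnS; apply: leq_trans le_xk; rewrite ltnS; apply: proper_card.
rewrite properEneq nyx; move: dxy.
by rewrite disjoint_sym disjoints_subset setCK.
Qed.

(** * Walks and the sign matrix *)

(* An enumeration of all subsets (by rank) that extends inclusion and lists the sets with
   fewer than 6 elements before all others. The pred_set of a set of rank larger than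
   rank base is the immediately preceding one; for smaller ones it only has to contain the
   core and come earlier. *)
Record walk (m : nat) := Walk {
  rank : {set 'I_m} -> nat;
  pred_set : {set 'I_m} -> {set 'I_m};
  core : {set 'I_m} -> {set 'I_m};
  base : {set 'I_m};
  rank_inj : injective rank;
  rank_sub : forall A B : {set 'I_m}, A \subset B -> (rank A <= rank B)%N;
  core_sub : forall A, core A \subset A;
  core_prev : forall A, core A \subset pred_set A;
  card_core : forall A, #|core A| = (#|A| - 2)%N;
  rank_prev : forall A : {set 'I_m}, (2 <= #|A|)%N -> (rank (pred_set A) < rank A)%N;
  large_rank : forall A : {set 'I_m}, (6 <= #|A|)%N = (rank base <= rank A)%N;
  rank_prevS : forall A, (rank base < rank A)%N -> rank A = (rank (pred_set A)).+1 }.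

Lemma rank_lt m (W : walk m) (A B : {set 'I_m}) : A \subset B -> A != B -> (rank W A < rank W B)%N.
Proof.
by move=> sAB nAB; rewrite ltn_neqAle rank_sub // andbT (inj_eq (@rank_inj m W)).
Qed.

Definition gate m (W : walk m) (A x : {set 'I_m}) : int :=
  if [disjoint core W A & x] then chi A x else - chi (pred_set W A) x.

Definition rowsum m (W : walk m) (A : {set 'I_m}) n : int := \sum_x gate W A x * n x.

Lemma gate_cases m (W : walk m) A x : gate W A x = 1 \/ gate W A x = -1.
Proof.
rewrite /gate; case: ifP => _; first exact: chi_cases.
by case: (chi_cases (pred_set W A) x) => ->; rewrite ?opprK; [right|left].
Qed.

Lemma gate_small m (W : walk m) (A : {set 'I_m}) x : (#|A| <= 2)%N -> gate W A x = chi A x.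
Proof.
move=> A2; have /eqP : #|core W A| = 0%N by rewrite card_core; apply/eqP.
by rewrite cards_eq0 /gate => /eqP ->; rewrite disjoints_subset sub0set.
Qed.

Lemma rowsum_small m (W : walk m) (A : {set 'I_m}) n :
  (#|A| <= 2)%N -> rowsum W A n = walsh A n.
Proof. by move=> A2; apply: eq_bigr => x _; rewrite gate_small. Qed.

(** By [sum_chi] the indicator of the subcube avoiding the core is an average of the [chi B] with
    [B] inside the core, and [chi B] turns [chi C] into [chi (C :\: B)]. The part off the subcube is
    the full sum minus this one. *)
Lemma rowsum_walsh m (W : walk m) (A : {set 'I_m}) n :
  2 ^+ #|core W A| * rowsum W A n =
  \sum_(B : {set 'I_m} | B \subset core W A)
    (walsh (A :\: B) n + walsh (pred_set W A :\: B) n)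
  - 2 ^+ #|core W A| * walsh (pred_set W A) n.
Proof.
have sC (C : {set 'I_m}) : core W A \subset C ->
    \sum_(B : {set 'I_m} | B \subset core W A) walsh (C :\: B) n =
    2 ^+ #|core W A| * \sum_(x : {set 'I_m} | [disjoint core W A & x]) chi C x * n x.
  move=> sAC; rewrite exchange_big mulr_sumr [RHS]big_mkcond; apply: eq_bigr => x _.
  under eq_bigr => B sB do rewrite chiD ?(subset_trans sB) // mulrAC.
  by rewrite -mulr_sumr sum_chi; case: ifP; rewrite ?mulr0 // mulrC.
rewrite big_split /= !sC ?core_sub ?core_prev //.
rewrite -mulrDr -mulrBr; congr (_ * _).
pose P (x : {set 'I_m}) := [disjoint core W A & x].
rewrite /rowsum /walsh [LHS](bigID P) [X in _ = _ - X](bigID P) /=.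
rewrite opprD addrA addrK; congr (_ + _).
  by apply: eq_bigr => x; rewrite /P /gate => ->.
by rewrite -sumrN; apply: eq_bigr => x; rewrite /P /gate => /negbTE ->; rewrite mulNr.
Qed.

(** * Sparsity of the lattice spanned by the columns *)

Lemma setD_subset_neq (T : finType) (A B : {set T}) : B \subset A -> B != set0 -> A :\: B != A.
Proof.
move=> sBA /set0Pn[b bB]; apply/eqP => /setP /(_ b).
by rewrite !inE bB (subsetP sBA).
Qed.

(* Coefficients of smaller rank being zero, sum_walsh makes 2 ^ |A| divide the coefficient
   at A while the row sum only loses 2 ^ (|A| - 2): this is where the factor 4 comes from. *)
Lemma walsh_leading m (W : walk m) (A : {set 'I_m}) n : (2 <= #|A|)%N ->
  (forall B, (rank W B < rank W A)%N -> walsh B n = 0) ->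
  walsh A n = 2 ^+ #|core W A| * rowsum W A n /\
  exists c : int, walsh A n = 2 ^+ #|A| * c /\ rowsum W A n = 4 * c.
Proof.
move=> A2 z0.
have sD (C B : {set 'I_m}) : C :\: B \subset C by apply: subsetDl.
have zA : walsh A n = 2 ^+ #|core W A| * rowsum W A n.
  rewrite rowsum_walsh (z0 (pred_set W A)) ?rank_prev // mulr0 subr0.
  rewrite (bigD1 set0) ?sub0set //= !setD0 (z0 (pred_set W A)) ?rank_prev // addr0.
  rewrite big1 ?addr0 // => B /andP[sB nB]; rewrite !z0 ?addr0 //.
    by apply: leq_ltn_trans (rank_prev W A2); apply: rank_sub.
  by apply: rank_lt => //; apply: setD_subset_neq; rewrite // (subset_trans sB) ?core_sub.
split=> //; exists (\sum_(x : {set 'I_m} | [disjoint A & x]) n x).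
have zA' : walsh A n = 2 ^+ #|A| * \sum_(x : {set 'I_m} | [disjoint A & x]) n x.
  rewrite -sum_walsh (bigD1 A) //= big1 ?addr0 // => B /andP[sB nB].
  by rewrite z0 // rank_lt.
split=> //; apply: (@mulfI _ (2 ^+ #|core W A|)); first by rewrite expf_neq0.
rewrite -zA zA' mulrA; congr (_ * _).
by rewrite card_core -[in LHS](subnK A2) exprD.
Qed.

(** Induction along the rank: once all earlier coefficients vanish, [walsh_leading] makes the row
    sum a multiple of 4, so the bound forces it, and the coefficient with it, to be 0. *)
Lemma rowsum_eq0 m (W : walk m) n :
  (forall A : {set 'I_m}, (#|A| <= 1)%N -> rowsum W A n = 0) ->
  (forall A : {set 'I_m}, (2 <= #|A|)%N -> `|rowsum W A n| < 4) ->
  forall x, n x = 0.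
Proof.
move=> r0 r4; apply: walsh_eq0 => A.
have [k] := ubnP (rank W A); elim: k => // k IHk in A *; rewrite ltnS => rAk.
have [A1 | A2] := leqP #|A| 1.
  by rewrite -(rowsum_small W) ?r0 // (leq_trans A1).
have [|_ [c [-> rc]]] := @walsh_leading _ W A n A2.
  by move=> B rBA; apply: IHk; apply: leq_trans rAk.
suff -> : c = 0 by rewrite mulr0.
have := r4 A A2; rewrite rc; lia.
Qed.

Lemma rowsumD m (W : walk m) A n1 n2 :
  rowsum W A (fun x => n1 x + n2 x) = rowsum W A n1 + rowsum W A n2.
Proof. by rewrite -big_split; apply: eq_bigr => x _; rewrite mulrDr. Qed.

Lemma rowsumZ m (W : walk m) A c n :
  rowsum W A (fun x => c * n x) = c * rowsum W A n.
Proof. by rewrite mulr_sumr; apply: eq_bigr => x _; rewrite mulrCA. Qed.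

Lemma rowsumB m (W : walk m) A n1 n2 :
  rowsum W A (fun x => n1 x - n2 x) = rowsum W A n1 - rowsum W A n2.
Proof. by rewrite -sumrB; apply: eq_bigr => x _; rewrite mulrBr. Qed.

Lemma walshD m (A : {set 'I_m}) n1 n2 :
  walsh A (fun x => n1 x + n2 x) = walsh A n1 + walsh A n2.
Proof. by rewrite -big_split; apply: eq_bigr => x _; rewrite mulrDr. Qed.

Lemma walshZ m (A : {set 'I_m}) c n : walsh A (fun x => c * n x) = c * walsh A n.
Proof. by rewrite mulr_sumr; apply: eq_bigr => x _; rewrite mulrCA. Qed.

Definition unit_at m (x y : {set 'I_m}) : int := (y == x)%:R.

Lemma walsh_unit m (A x : {set 'I_m}) : walsh A (unit_at x) = chi A x.
Proof.
rewrite /walsh (bigD1 x) //= big1 /unit_at ?eqxx ?mulr1 ?addr0 // => y /negbTE ->.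
by rewrite mulr0.
Qed.

Lemma rowsum_unit m (W : walk m) (A x : {set 'I_m}) : rowsum W A (unit_at x) = gate W A x.
Proof.
rewrite /rowsum (bigD1 x) //= big1 /unit_at ?eqxx ?mulr1 ?addr0 // => y /negbTE ->.
by rewrite mulr0.
Qed.

Lemma rowsum_parity m (W : walk m) A n :
  exists c : int, rowsum W A n = rowsum W set0 n + 2 * c.
Proof.
exists (\sum_x (if gate W A x == 1 then 0 else - n x)).
rewrite mulr_sumr -big_split; apply: eq_bigr => x _ /=.
rewrite (gate_small W (A := set0)) ?cards0 // chi_set0l.
by case: (gate_cases W A x) => -> /=; lia.
Qed.

(* An odd n has row sums 1 or -1, and the m + 1 rows with |A| <= 1 take every sign pattern
   on the columns up to sign; subtract the matching column and apply rowsum_eq0. *)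
Lemma rowsum_bounded1 m (W : walk m) n :
  (forall A, `|rowsum W A n| <= 1) ->
  (forall x, n x = 0) \/
  exists (e : int) (x0 : {set 'I_m}), (e = 1 \/ e = -1) /\ forall x, n x = e * unit_at x0 x.
Proof.
move=> r1; have := r1 set0; set e := rowsum W set0 n => e1.
have [e0 | en0] := eqVneq e 0.
  left; have r0 A : rowsum W A n = 0.
    have [c] := rowsum_parity W A n; rewrite -/e e0; have := r1 A; lia.
  by apply: (rowsum_eq0 (W := W)) => A _; rewrite r0.
have rpm A : rowsum W A n = 1 \/ rowsum W A n = -1.
  have [c] := rowsum_parity W A n; have := r1 A; rewrite -/e; lia.
right; exists e, [set b | rowsum W [set b] n != e]; set x0 := [set b | _].
have epm : e = 1 \/ e = -1 by apply: rpm.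
split=> // x; apply/eqP; rewrite -subr_eq0; apply/eqP; move: x.
apply: (rowsum_eq0 (W := W)) => A cA.
  rewrite rowsumB rowsumZ rowsum_unit gate_small; last exact: leq_trans cA _.
  case: (posnP #|A|) => [/eqP | A0].
    by rewrite cards_eq0 => /eqP ->; rewrite chi_set0l mulr1 subrr.
  have /cards1P[b ->] : #|A| == 1%N by rewrite eqn_leq cA.
  rewrite chi_set1l inE; by case: (rpm [set b]) epm => -> [] ->.
rewrite rowsumB rowsumZ rowsum_unit.
by case: (rpm A) epm (gate_cases W A x0) => -> [] -> [] ->.
Qed.

(** * The driver and the uniqueness of the relation *)

(* The sign at base W is opposite to all others. Otherwise the difference of columns set0
   and [set a] would already solve the system below. *)
Definition driver m (W : walk m) (a : 'I_m) (A : {set 'I_m}) : int :=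
  if (#|A| <= 1)%N then - (A == [set a])%:R else if A == base W then 1 else -1.

(** Adding the driver to such a row sum gives the driver or its negative, hence a coordinate in
    [-1, 1]. The rows with [#|A| <= 1] are prescribed exactly: 2 at [[set a]], 0 elsewhere. *)
Definition solves m (W : walk m) a n (A : {set 'I_m}) : Prop :=
  (rowsum W A n = 0 \/ rowsum W A n = -2 * driver W a A) /\
  ((#|A| <= 1)%N -> rowsum W A n = -2 * driver W a A).

Lemma card_base m (W : walk m) : (6 <= #|base W|)%N.
Proof. by rewrite (large_rank W). Qed.

Lemma driver_cases m (W : walk m) a A :
  driver W a A = 0 \/ driver W a A = 1 \/ driver W a A = -1.
Proof.
by rewrite /driver; case: ifP => _; case: eqP => _ /=; rewrite ?oppr0; auto.
Qed.

Lemma gate_set0 m (W : walk m) A : gate W A set0 = 1.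
Proof. by rewrite /gate disjoints_subset setC0 subsetT chi_set0r. Qed.

(** All row sums of [n'] share one parity. If even, row [[set a]] is 0 or 2, and [rowsum_eq0]
    applies to [n'] or [n' - n]. If odd, they are all 1 or -1, so by [rowsum_bounded1] a nonzero
    [n'] is a column up to sign, which a few rows exclude. *)
Lemma solves_unique m (W : walk m) a n n' :
  a \in base W -> a \notin core W (base W) ->
  (forall A, solves W a n A) ->
  (forall A, `|rowsum W A n' + driver W a A| <= 1) ->
  (forall x, n' x = 0) \/ (forall x, n' x = n x).
Proof.
move=> aF aC sn bn'.
have da : driver W a [set a] = -1 by rewrite /driver cards1 eqxx.
have dF : driver W a (base W) = 1.
  by rewrite /driver eqxx leqNgt (leq_trans _ (card_base W)).
have d1 (A : {set 'I_m}) : (#|A| <= 1)%N -> A != [set a] -> driver W a A = 0.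
  by rewrite /driver => -> /negbTE ->.
have [c0 r0] : exists c, rowsum W set0 n' = 2 * c \/ rowsum W set0 n' = 2 * c + 1.
  exists (rowsum W set0 n' %/ 2)%Z.
  have := divz_eq (rowsum W set0 n') 2.
  have := ltz_pmod (rowsum W set0 n') (isT : 0 < 2 :> int).
  have := modz_ge0 (rowsum W set0 n') (isT : 2 != 0 :> int).
  lia.
case: r0 => [ev | odd].
  have even A : exists c : int, rowsum W A n' = 2 * c.
    have [c] := rowsum_parity W A n'; rewrite ev => ->.
    by exists (c0 + c); rewrite mulrDr.
  have [ra0 | ra2] : rowsum W [set a] n' = 0 \/ rowsum W [set a] n' = 2.
    have [c] := even [set a]; have := bn' [set a]; rewrite da; lia.
  - left; apply: (rowsum_eq0 (W := W)) => A cA.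
      have [-> //|/d1 dA] := eqVneq A [set a].
      by have [c] := even A; have := bn' A; rewrite dA //; lia.
    have [c] := even A; have := bn' A; have := driver_cases W a A; lia.
  right=> x; apply/eqP; rewrite -subr_eq0; apply/eqP; move: x.
  apply: (rowsum_eq0 (W := W)) => A cA; rewrite rowsumB.
    rewrite (proj2 (sn A)) //.
    have [->|/d1 dA] := eqVneq A [set a]; first by rewrite ra2 da.
    by have [c] := even A; have := bn' A; rewrite dA //; lia.
  (* Both row sums lie in {0, -2u}, with u the driver at [A], so they differ by at most 2; bounding
     each by 2 alone would still allow 4. *)
  have [c] := even A; have := bn' A; have [+ _] := sn A.
  have := driver_cases W a A; lia.
have oddr A : exists c : int, rowsum W A n' = 2 * c + 1.
  have [c] := rowsum_parity W A n'; rewrite odd => ->.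
  by exists (c0 + c); lia.
have [z0 | [e [x [epm n'E]]]] : (forall x, n' x = 0) \/
    exists (e : int) (x0 : {set 'I_m}),
      (e = 1 \/ e = -1) /\ forall x, n' x = e * unit_at x0 x.
- apply: (rowsum_bounded1 (W := W)) => A.
  have [c] := oddr A; have := bn' A; have := driver_cases W a A; lia.
- by left.
have rE A : rowsum W A n' = e * gate W A x.
  by rewrite -rowsum_unit -rowsumZ; apply: eq_bigr => y _; rewrite n'E.
have ra : e * chi [set a] x = 1.
  rewrite -(gate_small W) ?cards1 // -rE.
  have [c] := oddr [set a]; have := bn' [set a]; rewrite da; lia.
have sx : x \subset [set a].
  apply/subsetP => b bx; rewrite inE; apply/negPn/negP => nba.
  have c2 : #|[set a; b]| = 2%N by rewrite cards2 eq_sym nba.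
  have rab : e * gate W [set a; b] x = 1.
    rewrite -rE; have [c] := oddr [set a; b]; have := bn' [set a; b].
    rewrite /driver c2 /= ifF ?lia //.
      lia.
    by apply/eqP => abF; have := card_base W; rewrite -abF c2.
  have chib : chi ([set a; b] :\: [set a]) x = -1.
    rewrite [_ :\: _](_ : _ = [set b]) ?chi_set1l ?bx //.
    apply/setP => i; rewrite !inE.
    by have [->|] := eqVneq i a; rewrite //= eq_sym (negbTE nba).
  move: chib; rewrite chiD ?subsetUl //; rewrite gate_small ?c2 // in rab.
  case: (chi_cases [set a] x) (chi_cases [set a; b] x) epm ra rab => [] -> [] -> [] -> //=.
have rF : e * gate W (base W) x = -1.
  rewrite -rE; have [c] := oddr (base W); have := bn' (base W); rewrite dF; lia.
(* On both remaining columns the rows [base W] and [[set a]] agree, because [a] lies in [base W]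
   outside its core; yet the two row sums have opposite signs. *)
move: sx rF ra; rewrite subset1 => /orP[] /eqP ->.
  rewrite /gate disjoint_sym disjoints_subset sub1set inE aC.
  by rewrite !chi_set1r aF set11 => -> .
by rewrite gate_set0 chi_set0r => ->.
Qed.

(** * Cube waves and the existence of the relation *)

(** The tool for correcting rows one at a time: its Walsh coefficients live on the supersets of [A],
    so rows of smaller rank do not change, while row [A] changes by 4 if [2 <= #|A|]. *)
Definition cube_wave m (A x : {set 'I_m}) : int := if x \subset A then chi A x else 0.

Lemma walsh_cube_wave m (A B : {set 'I_m}) :
  walsh B (cube_wave A) = if A \subset B then 2 ^+ #|A| else 0.
Proof.
have -> : walsh B (cube_wave A) = \sum_(x : {set 'I_m} | x \subset A) chi x (A :\: B).
  rewrite [RHS]big_mkcond; apply: eq_bigr => x _; rewrite /cube_wave.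
  case: ifP => sxA; last by rewrite mulr0.
  rewrite /chi [x :&: _]setIC -!/(chi _ _).
  have -> : A :\: B = A :\: (A :&: B) by apply/setP=> i; rewrite !inE; case: (i \in A); case: (i \in B).
  rewrite chiD ?subsetIl // mulrC; congr (_ * _).
  by rewrite /chi -setIA [B :&: x]setIC setIA (setIidPr sxA) setIC.
rewrite sum_chi; congr (if _ then _ else _).
apply/idP/idP => [dAB | sAB].
  apply/subsetP => i iA; apply/negPn/negP => iB.
  by have := disjointFr dAB iA; rewrite !inE iA iB.
by rewrite disjoints_subset; apply/subsetP => i iA; rewrite !inE (subsetP sAB).
Qed.

Lemma rowsum_prefix m (W : walk m) A n :
  (forall B, (rank W B <= rank W A)%N -> walsh B n = 0) -> rowsum W A n = 0.
Proof.
move=> z0; have [A2 | A2] := leqP #|A| 2; first by rewrite rowsum_small // z0.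
have [|/esym/eqP + _] := @walsh_leading _ W A n (ltnW A2).
  by move=> B /ltnW; apply: z0.
by rewrite z0 // mulf_eq0 expf_eq0 andbF => /eqP.
Qed.

Lemma walsh_cube_wave_before m (W : walk m) A B :
  (rank W B < rank W A)%N -> walsh B (cube_wave A) = 0.
Proof.
move=> rBA; rewrite walsh_cube_wave ifF //; apply/negP => sAB.
by have := rank_sub W sAB; rewrite leqNgt rBA.
Qed.

Lemma rowsum_cube_wave_before m (W : walk m) A B :
  (rank W B < rank W A)%N -> rowsum W B (cube_wave A) = 0.
Proof.
move=> rBA; apply: rowsum_prefix => C rCB.
exact: (walsh_cube_wave_before (leq_ltn_trans rCB rBA)).
Qed.

Lemma rowsum_cube_wave m (W : walk m) (A : {set 'I_m}) :
  (2 <= #|A|)%N -> rowsum W A (cube_wave A) = 4.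
Proof.
move=> A2; have [|_ [c [zc ->]]] := @walsh_leading _ W A (cube_wave A) A2.
  by move=> B; apply: walsh_cube_wave_before.
move: zc; rewrite walsh_cube_wave subxx -[LHS]mulr1.
by move/mulfI => <- //; rewrite expf_neq0.
Qed.

(* The difference of two columns has all Walsh coefficients 0 or 2; the cube wave leaves
   those before base W untouched and makes the one at base W large. *)
Definition seed m (W : walk m) a (x : {set 'I_m}) : int :=
  unit_at set0 x - unit_at [set a] x - cube_wave (base W) x.

(** Starting from [seed], the rows past [base W] are corrected in rank order by multiples of
    [cube_wave A]; earlier rows and all coefficients up to [base W] stay as they are. *)
Lemma solves_exists m (W : walk m) a :
  a \in base W -> a \notin core W (base W) ->
  exists n, (forall A, solves W a n A) /\
    forall A, (rank W A <= rank W (base W))%N -> walsh A n = walsh A (seed W a).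
Proof.
move=> aF aC; have F2 : (2 <= #|base W|)%N by apply: leq_trans (card_base W).
suff step k : exists n,
    (forall A, (rank W A < rank W (base W) + k.+1)%N -> solves W a n A) /\
    forall A, (rank W A <= rank W (base W))%N -> walsh A n = walsh A (seed W a).
  have [n [sn zn]] := step (\max_(A : {set 'I_m}) rank W A); exists n; split=> // A.
  by apply: sn; rewrite addnS ltnS (leq_trans (leq_bigmax A)) ?leq_addl.
elim: k => [|k [n [sn zn]]].
  exists (seed W a); split=> // A; rewrite addn1 ltnS => rA.
  have rE : rowsum W A (seed W a) = 1 - gate W A [set a] - rowsum W A (cube_wave (base W)).
    by rewrite /seed !rowsumB !rowsum_unit gate_set0.
  rewrite /solves rE; have [-> | nAF] := eqVneq A (base W).
    (* At [base W] the row sum is 1 + 1 - 4 = -2, which suits the driver 1 there. *)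
    rewrite rowsum_cube_wave // /driver leqNgt F2 eqxx.
    rewrite /gate disjoint_sym disjoints_subset sub1set inE aC chi_set1r aF.
    by split=> //; right.
  rewrite rowsum_cube_wave_before ?subr0; last first.
    by rewrite ltn_neqAle rA andbT (inj_eq (@rank_inj m W)).
  rewrite /driver (negbTE nAF); case: leqP => A1; last first.
    by split=> //; case: (gate_cases W A [set a]) => ->; [left|right].
  rewrite gate_small ?(leq_trans A1) //.
  suff -> : 1 - chi A [set a] = - 2 * - (A == [set a])%:R by split=> //; right.
  rewrite chi_set1r; case: (posnP #|A|) => [/eqP | A0].
    rewrite cards_eq0 => /eqP ->; rewrite inE.
    by rewrite eq_sym -cards_eq0 cards1.
  have /cards1P[b ->] : #|A| == 1%N by rewrite eqn_leq A1.
  by rewrite inE (inj_eq set1_inj) eq_sym; case: eqP.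
have [A /eqP rA | noA] := pickP (fun A => rank W A == (rank W (base W) + k.+1)%N); last first.
  exists n; split=> // A; rewrite addnS ltnS leq_eqVlt => /orP[|]; last exact: sn.
  by rewrite noA.
have rFA : (rank W (base W) < rank W A)%N by rewrite rA addnS ltnS leq_addr.
have A6 : (6 <= #|A|)%N by rewrite (large_rank W) ltnW.
have [q vq] : exists q, rowsum W A n = 2 * q.
  have [c ->] := rowsum_parity W A n; exists c.
  rewrite (proj2 (sn set0 _)) ?cards0 //.
    by rewrite /driver cards0 /= eq_sym -cards_eq0 cards1 /= mulr0 add0r.
  by rewrite addnS ltnS (leq_trans (rank_sub W (sub0set (base W)))) ?leq_addr.
(* Past [base W] the driver is -1, so the allowed values are 0 and 2; an even row sum reaches one of
   them by adding a multiple of 4. *)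
have [c cE] : exists c, 2 * q + c * 4 = 0 \/ 2 * q + c * 4 = 2.
  exists (- (q %/ 2)%Z).
  have := divz_eq q 2.
  have := ltz_pmod q (isT : 0 < 2 :> int).
  have := modz_ge0 q (isT : 2 != 0 :> int).
  lia.
exists (fun x => n x + c * cube_wave A x); split=> B rB; last first.
  by rewrite walshD walshZ (@walsh_cube_wave_before _ W) ?mulr0 ?addr0 ?zn // (leq_ltn_trans rB).
have [-> | nBA] := eqVneq B A.
  rewrite /solves rowsumD rowsumZ rowsum_cube_wave ?(leq_trans _ A6) // vq /driver.
  have -> : (#|A| <= 1)%N = false by rewrite leqNgt (leq_trans _ A6).
  by rewrite ifF //; apply/eqP => AF; rewrite AF ltnn in rFA.
have rBA : (rank W B < rank W A)%N.
  by rewrite ltn_neqAle (inj_eq (@rank_inj m W)) nBA /= rA -ltnS -addnS.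
rewrite /solves rowsumD rowsumZ rowsum_cube_wave_before // mulr0 addr0.
by apply: sn; rewrite -rA.
Qed.

(** * Growth of the Walsh coefficients *)

(** Let q = 2^(|A|-3) and let Z be the size of the coefficient at [pred_set W A]. In [rowsum_walsh]
    the term 2qZ outweighs the rest: Z <= qZ/8, the nonempty subsets of the core give at most qZ/2,
    and the row sum at most 4q <= qZ/4. *)
Lemma walsh_step m (W : walk m) a n (A : {set 'I_m}) :
  (forall B, solves W a n B) -> (rank W (base W) < rank W A)%N ->
  16 <= `|walsh (pred_set W A) n| ->
  (forall B, (rank W B < rank W (pred_set W A))%N ->
     8 * `|walsh B n| <= `|walsh (pred_set W A) n|) ->
  8 <= 2 ^+ (#|A| - 3) :> int /\
  2 ^+ (#|A| - 3) * `|walsh (pred_set W A) n| <= `|walsh A n|.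
Proof.
set P := pred_set W A; set Z := `|walsh P n| => sn rFA Z16 Z8.
have A6 : (6 <= #|A|)%N by rewrite (large_rank W) ltnW.
have rAP : rank W A = (rank W P).+1 by apply: rank_prevS.
set q : int := 2 ^+ (#|A| - 3).
have q8 : 8 <= q.
  rewrite [8](_ : _ = 2 ^+ 3 :> int) // ler_eXn2l //.
  by rewrite leq_subRL ?(leq_trans _ A6).
split=> //.
have qE : 2 ^+ #|core W A| = 2 * q.
  by rewrite -exprS card_core -subSn ?(leq_trans _ A6).
have := rowsum_walsh W A n; rewrite qE.
rewrite (bigD1 set0) ?sub0set //= !setD0 -/P.
set S := (X in _ = _ + X - _).
have S8 : 8 * `|S| <= 2 * q * (2 * Z).
  have -> : 2 * q * (2 * Z) = \sum_(B : {set 'I_m} | B \subset core W A) 2 * Z.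
    rewrite sumr_const -qE -[RHS]mulr_natl; congr (_ * _).
    rewrite -natrX -(card_powerset (core W A)); congr (_%:R).
    by apply: eq_card => B; rewrite [in RHS]unfold_in inE.
  apply: (@le_trans _ _ (8 * \sum_(B : {set 'I_m} | (B \subset core W A) && (B != set0))
     (`|walsh (A :\: B) n| + `|walsh (P :\: B) n|))).
    rewrite ler_pM2l //; apply: le_trans (ler_norm_sum _ _ _) _.
    by apply: ler_sum => B _; apply: ler_normD.
  rewrite mulr_sumr [leRHS](bigID (fun B : {set 'I_m} => B != set0)) /=.
  rewrite -[leLHS]addr0; apply: lerD; last first.
    by apply: sumr_ge0 => B _; rewrite mulr_ge0 // normr_ge0.
  apply: ler_sum => B /andP[sB nB]; rewrite mulrDr [leRHS]mulr_natl mulr2n.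
  have rB (C : {set 'I_m}) : B \subset C -> (rank W (C :\: B) < rank W C)%N.
    by move=> sBC; apply: rank_lt; [apply: subsetDl | apply: setD_subset_neq].
  apply: lerD; apply: Z8; last by rewrite rB // (subset_trans sB) ?core_prev.
  (* [A :\: B] ranks at most at [P], and differs from [P] because [P] contains the nonempty [B]. *)
  have := rB A (subset_trans sB (core_sub W A)).
  rewrite rAP ltnS leq_eqVlt => /orP[/eqP/rank_inj AB | //].
  have [b bB] := set0Pn _ nB.
  have : b \in P by rewrite (subsetP (core_prev W A)) // (subsetP sB).
  by rewrite -AB !inE bB.
have w2 : `|rowsum W A n| <= 2.
  have [+ _] := sn A; have := driver_cases W a A; lia.
have qZ8 : 8 * Z <= q * Z by rewrite ler_wpM2r.
have qZ16 : q * 16 <= q * Z by rewrite ler_wpM2l // (le_trans _ q8).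
have qw : `|q * rowsum W A n| <= q * 2.
  by rewrite normrM ger0_norm ?(le_trans _ q8) // ler_wpM2l // (le_trans _ q8).
have qZ : `|q * walsh P n| = q * Z.
  by rewrite normrM ger0_norm ?(le_trans _ q8).
move: qZ8 qZ16 qw qZ S8; rewrite /Z -!mulrA [q * (2 * _)]mulrCA.
move: (q * rowsum W A n) (q * walsh P n) (q * `|walsh P n|) => X Y V; lia.
Qed.

(** Induction on the rank from [base W] on; the first two bounds are what [walsh_step] asks of the
    preceding set. At [base W] the coefficient is 2 - 2^|base W|, of size at least 62, and all
    earlier ones are 0 or 2. *)
Lemma walsh_growth m (W : walk m) a n (A : {set 'I_m}) :
  a \in base W ->
  (forall B, solves W a n B) ->
  (forall B, (rank W B <= rank W (base W))%N -> walsh B n = walsh B (seed W a)) ->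
  (rank W (base W) <= rank W A)%N ->
  [/\ 16 <= `|walsh A n|,
      forall B, (rank W B < rank W A)%N -> 8 * `|walsh B n| <= `|walsh A n|
    & 2 ^+ (\sum_(B : {set 'I_m} | (rank W (base W) <= rank W B <= rank W A)%N) (#|B| - 3))
        <= `|walsh A n|].
Proof.
move=> aF sn zn; move: {2}(rank W A - _)%N (erefl (rank W A - rank W (base W))%N) => k.
elim: k A => [|k IHk] A rk rFA.
  have AF : A = base W.
    by apply: (@rank_inj m W); apply/eqP; rewrite eqn_leq rFA -subn_eq0 rk.
  rewrite AF.
  have p6 : 64 <= 2 ^+ #|base W| :> int.
    by rewrite [64](_ : _ = 2 ^+ 6 :> int) // ler_eXn2l // card_base.
  have zE B : walsh B (seed W a) = 1 - chi B [set a] - walsh B (cube_wave (base W)).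
    rewrite /seed -[1](chi_set0r B) -!walsh_unit /walsh -!sumrB.
    by apply: eq_bigr => x _; rewrite !mulrBr.
  have zF : walsh (base W) n = 2 - 2 ^+ #|base W|.
    by rewrite zn // zE chi_set1r aF walsh_cube_wave subxx.
  split.
  - rewrite zF; lia.
  - move=> B rB; have -> : walsh B n = 1 - chi B [set a].
      by rewrite (zn _ (ltnW rB)) zE (walsh_cube_wave_before rB) subr0.
    rewrite zF; move: p6; move: (2 ^+ #|base W|) => X; clear; case: (chi_cases B [set a]) => ->; lia.
  rewrite (bigD1 (base W)) ?leqnn //= big1 ?addn0 => [|B /andP[rB /negP[]]]; last first.
    by apply/eqP/(@rank_inj m W)/eqP; rewrite eqn_leq andbC.
  rewrite zF; have : 2 ^+ #|base W| = 8 * 2 ^+ (#|base W| - 3) :> int.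
    rewrite [8](_ : _ = 2 ^+ 3 :> int) // -exprD subnKC //.
    exact: leq_trans (card_base W).
  by move: p6; move: (2 ^+ #|base W|) (2 ^+ (_ - 3)) => X Y; lia.
have rFltA : (rank W (base W) < rank W A)%N by rewrite -subn_gt0 rk.
have rAP := rank_prevS rFltA; set P := pred_set W A in rAP.
have [|| Z16 Z8 ZP] := IHk P; rewrite ?rAP in rk rFltA *; try lia.
have rFltA' : (rank W (base W) < rank W A)%N by rewrite rAP.
have [q8 zA] := walsh_step sn rFltA' Z16 Z8.
have ZA : 8 * `|walsh P n| <= `|walsh A n|.
  by apply: le_trans zA; rewrite ler_wpM2r.
split.
- by apply: le_trans ZA; move: Z16; lia.
- move=> B; rewrite ltnS leq_eqVlt => /orP[/eqP/rank_inj -> // | /Z8].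
  by move: ZA; lia.
rewrite (bigD1 A) /=; last by rewrite rAP leqnn andbT -rAP ltnW.
rewrite exprD (eq_bigl (fun B : {set 'I_m} => rank W (base W) <= rank W B <= rank W P)%N).
  by apply: le_trans zA; rewrite ler_wpM2l // (le_trans _ q8).
move=> B /=; rewrite -(inj_eq (@rank_inj m W)) rAP.
by clear; lia.
Qed.

(** * From an integer relation to a minimal sequence *)

(** Indexes the vectors of the sequence: [None] is the driver, [Some] holds a column with the number
    of a copy. *)
Definition item (X : finType) (k : X -> nat) : finType := option {x : X & 'I_(k x)}.

Lemma sum_item (V : nmodType) (X : finType) (k : X -> nat) (A : {set item k})
    (F : item k -> V) :
  \sum_(p in A) F p = (if None \in A then F None else 0) +
    \sum_x \sum_(i : 'I_(k x) | Some (Tagged (fun x => 'I_(k x)) i) \in A)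
      F (Some (Tagged (fun x => 'I_(k x)) i)).
Proof.
rewrite (bigID isSome) /= [LHS]addrC; congr (_ + _).
  case NA: (None \in A).
    by rewrite (big_pred1 None) // => -[p|]; rewrite ?andbF ?NA.
  by rewrite big_pred0 // => -[p|]; rewrite ?andbF ?NA.
rewrite (reindex_omap (Some : _ -> item k) id); last by case=> [//|]; rewrite andbF.
rewrite sig_big_dep; apply: eq_big => [[x i]|[x i] _] //=.
by rewrite !eqxx !andbT.
Qed.

(** An index set amounts to its signed copy counts, an integer vector between 0 and [n], taken with
    or without [u]. If its sum is in the cube, the last two hypotheses leave at most one vector
    without [u], and with [u] only [u] alone or the whole sequence. *)
Lemma minimal_seq_of_relation (R : realType) d (X Y : finType) (M : Y -> X -> int)
    (u : Y -> int) (n : X -> int) :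
  #|Y| = d -> (forall y x, `|M y x| <= 1) -> (forall y, `|u y| <= 1) ->
  (forall y, `|\sum_x M y x * n x + u y| <= 1) ->
  (exists x, n x != 0) ->
  (forall n', (forall y, `|\sum_x M y x * n' x| <= 1) -> \sum_x `|n' x| <= 1) ->
  (forall n', (forall y, `|\sum_x M y x * n' x + u y| <= 1) ->
     (forall x, n' x = 0) \/ (forall x, n' x = n x)) ->
  exists (t : nat) (v : 'I_t -> 'rV[R]_d), minimal_seq v /\ \sum_x `|n x| <= t%:Z.
Proof.
move=> cY M1 u1 tot [x0 nx0] sub1 sub2.
pose k x := `|n x|%N; pose w (p : item k) y : int :=
  if p is Some q then sgz (n (tag q)) * M y (tag q) else u y.
have w1 p y : `|w p y| <= 1.
  case: p => [q|] //=; rewrite normrM; have := M1 y (tag q).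
  by case: (sgzP (n (tag q))) => _; rewrite ?normrN ?normr1 ?normr0 ?mul0r ?mul1r.
pose cnt (A : {set item k}) x : nat :=
  #|[set i : 'I_(k x) | Some (Tagged (fun x => 'I_(k x)) i) \in A]|.
have cnt_le (A : {set item k}) x : (cnt A x <= k x)%N.
  by rewrite -[leqRHS]card_ord max_card.
have sumE (A : {set item k}) y : \sum_(p in A) w p y =
    \sum_x M y x * (sgz (n x) * (cnt A x)%:Z) + (if None \in A then u y else 0).
  rewrite sum_item addrC; congr (_ + _); apply: eq_bigr => x _ /=.
  rewrite sumr_const -mulr_natr natz mulrAC mulrC; congr (_ * (_ * _%:Z)).
  by apply: eq_card => i; rewrite inE.
have cardE (A : {set item k}) : #|A|%:Z = (None \in A)%:Z + \sum_x (cnt A x)%:Z.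
  rewrite -[LHS]natz -sum1_card natr_sum sum_item; congr (_ + _); first by case: ifP.
  apply: eq_bigr => x _; rewrite sumr_const -[RHS]natz; congr (_ *+ _).
  by apply: eq_card => i; rewrite inE.
have norm_cnt (A : {set item k}) x : `|sgz (n x) * (cnt A x)%:Z| = (cnt A x)%:Z.
  have := cnt_le A x; rewrite /k normrM.
  by case: (sgzP (n x)) => nx; rewrite ?nx ?normrN ?normr1 ?normr0 ?mul0r ?mul1r //; lia.
pose T := item k.
have kE x : (cnt setT x)%:Z = `|n x|.
  by rewrite /cnt (_ : [set _ | _] = setT) ?cardsT ?card_ord //; apply/setP=> i; rewrite !inE.
have nE x : sgz (n x) * (cnt setT x)%:Z = n x by rewrite kE; case: (sgzP (n x)); lia.
have cardT : #|T|%:Z = 1 + \sum_x `|n x|.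
  by rewrite -cardsT cardE inE; congr (_ + _); apply: eq_bigr => x _.
exists #|T|.
pose row_of (i : 'I_d) : Y := enum_val (cast_ord (esym cY) i).
have row_ofK y : row_of (cast_ord cY (enum_rank y)) = y.
  by rewrite /row_of cast_ordK enum_rankK.
pose v (j : 'I_#|T|) : 'rV[R]_d := \row_i (w (enum_val j) (row_of i))%:~R.
exists v.
have intr1 (z : int) : (`|z%:~R| <= 1 :> R) = (`|z| <= 1).
  by rewrite -intr_norm -[leRHS]/(1%:~R) ler_int.
have sumV (S : {set 'I_#|T|}) :
    in_cube (\sum_(j in S) v j) <->
    forall y, `|\sum_(p in [set enum_val j | j in S]) w p y| <= 1.
  have E i : (\sum_(j in S) v j) 0 i =
      (\sum_(p in [set enum_val j | j in S]) w p (row_of i))%:~R.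
    rewrite summxE big_imset /= => [|? ? _ _]; last exact: enum_val_inj.
    by rewrite rmorph_sum; apply: eq_bigr => j _; rewrite mxE.
  split=> [cS y | cS i]; last by rewrite E intr1; apply: cS.
  by have := cS (cast_ord cY (enum_rank y)); rewrite E row_ofK intr1.
have card_im (S : {set 'I_#|T|}) : #|[set enum_val j | j in S] : {set T}| = #|S|.
  by rewrite card_imset //; apply: enum_val_inj.
split; last by rewrite cardT; lia.
have T2 : (2 <= #|T|)%N.
  have : `|n x0| <= \sum_x `|n x| by rewrite (bigD1 x0) //= lerDl sumr_ge0.
  lia.
split=> //; split; [|split].
- by move=> j i; rewrite mxE intr1.
- have -> : \sum_j v j = \sum_(j in [set: 'I_#|T|]) v j.
    by apply: eq_bigl => j; rewrite inE.
  apply/sumV => y; have -> : [set enum_val j | j in [set: 'I_#|T|]] = [set: T].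
    by apply/eqP; rewrite eqEcard subsetT card_im !cardsT card_ord leqnn.
  rewrite sumE inE; have := tot y; congr (`|_ + _| <= 1).
  by apply: eq_bigr => x _; rewrite nE.
move=> S S2 St /sumV; set A := [set enum_val j | j in S] => cA.
have := cardE A; rewrite card_im.
under eq_bigr => x _ do rewrite -norm_cnt.
case NA: (None \in A) => cS.
- have [y|n0|nn] := sub2 (fun x => sgz (n x) * (cnt A x)%:Z).
  + by have := cA y; rewrite sumE NA.
  + by move: cS; rewrite big1 => [|x _]; [lia | rewrite n0].
  move: cS; under eq_bigr => x _ do rewrite nn.
  by move=> cS; move: St; rewrite -ltz_nat cS cardT ltxx.
have : \sum_x `|sgz (n x) * (cnt A x)%:Z| <= 1.
  by apply: sub1 => y; have := cA y; rewrite sumE NA addr0.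
by rewrite -[leLHS]add0r -[0]/(false%:Z) -cS lez_nat leqNgt S2.
Qed.

(** * Binary order on subsets and the construction of a walk *)

Fixpoint subsets m (j : nat) : seq {set 'I_m.+1} :=
  if j is i.+1 then subsets m i ++ [seq inord i |: A | A <- subsets m i] else [:: set0].

Lemma mem_subsets m j (A : {set 'I_m.+1}) : (j <= m.+1)%N ->
  (A \in subsets m j) = (A \subset [set i : 'I_m.+1 | (i < j)%N]).
Proof.
elim: j A => [|j IHj] A jm.
  rewrite inE; apply/eqP/idP => [-> | /subsetP sA]; first exact: sub0set.
  by apply/setP => i; rewrite inE; apply/negP => /sA; rewrite inE.
have vj : (inord j : 'I_m.+1) = j :> nat by rewrite inordK.
rewrite mem_cat IHj ?(ltnW jm) //; apply/orP/subsetP => [[/subsetP sA i /sA | /mapP[B]] | sA].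
- by rewrite !inE => /ltnW.
- rewrite IHj ?(ltnW jm) // => /subsetP sB -> i; rewrite !inE => /orP[/eqP -> | /sB].
    by rewrite vj.
  by rewrite inE => /ltnW.
have [jA | jA] := boolP (inord j \in A).
  right; rewrite -(setD1K jA); apply: map_f; rewrite IHj ?(ltnW jm) //.
  apply/subsetP => i; rewrite !inE => /andP[nij /sA]; rewrite inE ltnS leq_eqVlt.
  by case/orP=> // /eqP ij; rewrite -val_eqE /= vj ij eqxx in nij.
left; apply/subsetP => i iA; have := sA i iA; rewrite !inE ltnS leq_eqVlt.
case/orP=> // /eqP ij; case/negP: jA.
by rewrite (_ : inord j = i) //; apply: val_inj; rewrite /= vj.
Qed.

Lemma notin_subsets m j (A : {set 'I_m.+1}) : (j < m.+1)%N ->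
  A \in subsets m j -> inord j \notin A.
Proof.
move=> jm; rewrite mem_subsets ?(ltnW jm) // => /subsetP sA.
by apply/negP => /sA; rewrite inE inordK // ltnn.
Qed.

Lemma subsets_pairwise m j : (j <= m.+1)%N ->
  pairwise (fun A B : {set 'I_m.+1} => ~~ (B \subset A)) (subsets m j).
Proof.
elim: j => [|j IHj] jm //=; rewrite pairwise_cat pairwise_map IHj ?(ltnW jm) //=.
apply/andP; split.
  apply/allrelP => A _ As /mapP[B _ ->]; apply/subsetPn; exists (inord j).
    by rewrite setU11.
  exact: notin_subsets As.
apply: (sub_in_pairwise (P := mem (subsets m j))) (IHj (ltnW jm)); last exact/allP.
move=> A B _ Bs /=; apply: contra => /subsetP sBA; apply/subsetP => i iB.
have := sBA i; rewrite !inE iB orbT => /(_ isT) /orP[/eqP ij | //].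
by have := notin_subsets jm Bs; rewrite -ij iB.
Qed.

(* subsets lists sets in binary order; keeping only the large ones, consecutive sets still
   have an intersection that is big enough to contain a core. *)
Definition near m (A B : {set 'I_m}) := (#|B| <= #|A :&: B| + 2)%N.

(** [K] varies because removing the newest element lowers the threshold by one. The last set is
    tracked for the junction of the two halves: it is the whole initial segment, so it contains the
    next set up to the newest element. *)
Lemma subsets_large_near m j K : (j <= m.+1)%N ->
  let s := [seq A : {set 'I_m.+1} <- subsets m j | (K <= #|A|)%N] in
  sorted (@near _) s /\ (s != [::] -> last set0 s = [set i : 'I_m.+1 | (i < j)%N]).
Proof.
elim: j K => [|j IHj] K jm /=.
  case: ifP => //= _; split=> // _; apply/setP => i; by rewrite !inE.
have jE : [set i : 'I_m.+1 | (i < j.+1)%N] = inord j |: [set i : 'I_m.+1 | (i < j)%N].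
  by apply/setP => i; rewrite !inE -val_eqE /= inordK // ltnS leq_eqVlt.
have cardU (A : {set 'I_m.+1}) : A \in subsets m j -> #|inord j |: A| = #|A|.+1.
  by move=> As; rewrite cardsU1 notin_subsets.
have -> : [seq A : {set 'I_m.+1} <- subsets m j ++ [seq inord j |: A | A <- subsets m j] | (K <= #|A|)%N] =
    [seq A : {set 'I_m.+1} <- subsets m j | (K <= #|A|)%N] ++
    [seq inord j |: A | A : {set 'I_m.+1} <- [seq A : {set 'I_m.+1} <- subsets m j | (K.-1 <= #|A|)%N]].
  rewrite filter_cat filter_map; congr (_ ++ map _ _).
  by apply: eq_in_filter => A /cardU /= ->; case: K.
have [s1 l1] := IHj K (ltnW jm); have [s2 l2] := IHj K.-1 (ltnW jm).
set S1 := [seq A : {set 'I_m.+1} <- _ | (K <= #|A|)%N] in s1 l1 *.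
set S2 := [seq A : {set 'I_m.+1} <- _ | (K.-1 <= #|A|)%N] in s2 l2 *.
have S2j A : A \in S2 -> A \in subsets m j by rewrite mem_filter => /andP[].
have sub12 A : A \in S1 -> A \in S2.
  by rewrite !mem_filter => /andP[KA ->]; rewrite andbT (leq_trans (leq_pred K)).
have s2' : sorted (@near _) [seq inord j |: A | A <- S2].
  rewrite sorted_map; apply: (sub_in_sorted (P := mem S2)) s2; last exact/allP.
  move=> A B /= /S2j /(notin_subsets jm) jA /S2j /(notin_subsets jm) jB.
  by rewrite /near /= -setUIr !cardsU1 inE (negbTE jA) jB.
split.
  case ES1: S1 s1 l1 => [|x t] //= s1 /(_ isT) l1; rewrite cat_path s1 l1 /=.
  case ES2: S2 s2' S2j => [|y t'] //= -> S2j; rewrite andbT.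
  have yj := S2j y (mem_head _ _); have yjs := yj; rewrite mem_subsets ?(ltnW jm) // in yjs.
  rewrite /near cardU // addn2 ltnS ltnW // ltnS subset_leq_card //.
  by rewrite subsetI yjs subsetUr.
rewrite last_cat jE => nS; case ES2: S2 l2 => [|y t] l2; last first.
  by rewrite -l2 //= last_map.
case ES1: S1 nS sub12 => [|x t] nS sub12; first by rewrite ES2 in nS.
by have := sub12 x (mem_head _ _); rewrite ES2.
Qed.

Definition sub_card (T : finType) (k : nat) (A : {set T}) : {set T} :=
  [set x in take k (enum A)].

Lemma sub_card_sub (T : finType) k (A : {set T}) : sub_card k A \subset A.
Proof. by apply/subsetP => x; rewrite inE => /mem_take; rewrite mem_enum. Qed.

Lemma card_sub_card (T : finType) k (A : {set T}) : (k <= #|A|)%N -> #|sub_card k A| = k.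
Proof.
move=> kA; rewrite cardsE (card_uniqP _) ?take_uniq ?enum_uniq //.
by rewrite size_takel // -cardE.
Qed.

(** The small sets come first, then the large ones, each in binary order. Past the first large set
    the core is taken inside the intersection with the preceding set, which [near] makes big enough;
    up to there the core also serves as [pred_set]. *)
Lemma walk_exists m : (5 <= m)%N -> inhabited (walk m.+1).
Proof.
move=> m5; pose T := {set 'I_m.+1}.
pose small := [seq A : T <- subsets m m.+1 | (#|A| < 6)%N].
pose large := [seq A : T <- subsets m m.+1 | (6 <= #|A|)%N].
pose s := small ++ large; pose rk (A : T) := index A s.
have memS (A : T) : A \in subsets m m.+1.
  by rewrite mem_subsets //; apply/subsetP => i _; rewrite inE.
have mem_small (A : T) : (A \in small) = (#|A| < 6)%N by rewrite mem_filter memS andbT.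
have mem_large (A : T) : (A \in large) = (6 <= #|A|)%N by rewrite mem_filter memS andbT.
have mem_s (A : T) : A \in s by rewrite mem_cat mem_small mem_large ltnNge orNb.
have rk_lt A : (rk A < size s)%N by rewrite index_mem.
have nth_rk A : nth set0 s (rk A) = A by rewrite nth_index.
have rk_inj : injective rk by move=> A B rAB; rewrite -[A]nth_rk rAB nth_rk.
have pw := subsets_pairwise (leqnn m.+1).
have pw_s : pairwise (fun A B : T => ~~ (B \subset A)) s.
  rewrite pairwise_cat !pairwise_filter // !andbT.
  apply/allrelP => A B; rewrite mem_small mem_large => A6 B6.
  by apply/negP => /subset_leq_card; rewrite leqNgt (leq_trans A6 B6).
have rk_sub (A B : T) : A \subset B -> (rk A <= rk B)%N.
  move=> sAB; rewrite leqNgt; apply/negP => rBA.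
  have /(_ _ _ (rk_lt B) (rk_lt A) rBA) := pairwiseP set0 pw_s.
  by rewrite !nth_rk sAB.
have rk_ltn (A B : T) : A \subset B -> A != B -> (rk A < rk B)%N.
  by move=> sAB nAB; rewrite ltn_neqAle (inj_eq rk_inj) nAB rk_sub.
have s_uniq : uniq s by apply: pairwise_uniq pw_s => A; rewrite subxx.
have rk_large (A : T) : (6 <= #|A|)%N -> rk A = (size small + index A large)%N.
  by move=> A6; rewrite /rk index_cat mem_small ltnNge A6.
have large0 : (0 < size large)%N.
  by rewrite -has_predT; apply/hasP; exists [set: 'I_m.+1]; rewrite // mem_large cardsT card_ord.
pose fst := nth set0 large 0.
have fst6 : (6 <= #|fst|)%N by rewrite -mem_large mem_nth.
have rk_fst : rk fst = size small.
  rewrite rk_large // index_uniq // ?addn0 //.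
  by move: s_uniq; rewrite cat_uniq => /and3P[].
have large_rk (A : T) : (6 <= #|A|)%N = (rk fst <= rk A)%N.
  rewrite rk_fst; have [A6 | A6] := leqP 6 #|A|; first by rewrite rk_large // leq_addr.
  by apply/esym/negbTE; rewrite -ltnNge /rk index_cat mem_small A6 index_mem mem_small.
pose before (A : T) := nth set0 s (rk A).-1.
have rk_before (A : T) : (rk fst < rk A)%N -> rk A = (rk (before A)).+1.
  move=> rA; have A0 := leq_ltn_trans (leq0n _) rA.
  by rewrite /rk index_uniq ?prednK // (leq_trans _ (rk_lt A)) // prednK.
have near_before (A : T) : (rk fst < rk A)%N -> near (before A) A.
  move=> rA; have rB := rk_before A rA; rewrite rB ltnS rk_fst in rA.
  have [large_near _] := @subsets_large_near m m.+1 6 (leqnn _).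
  have := sortedP set0 large_near (rk (before A) - size small)%N.
  have nl k : nth set0 large k = nth set0 s (size small + k).
    by rewrite nth_cat ltnNge leq_addr addKn.
  rewrite -/large !nl addnS subnKC // -rB !nth_rk; apply.
  by rewrite -(ltn_add2l (size small)) addnS subnKC // -rB -size_cat.
pose core (A : T) :=
  sub_card (#|A| - 2) (if (rk fst < rk A)%N then before A :&: A else A).
pose prv (A : T) := if (rk fst < rk A)%N then before A else core A.
have core_sub (A : T) : core A \subset A.
  by rewrite (subset_trans (sub_card_sub _ _)) //; case: ifP => _; rewrite ?subsetIr.
have card_core (A : T) : #|core A| = (#|A| - 2)%N.
  rewrite card_sub_card //; case: ifP => rA; last exact: leq_subr.
  by rewrite leq_subLR addnC; apply: near_before.
split; apply: (@Walk m.+1 rk prv core fst) => //.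
- move=> A; rewrite /prv; case: ifP => rA //.
  by rewrite /core rA (subset_trans (sub_card_sub _ _)) // subsetIl.
- move=> A A2; rewrite /prv; case: ifP => rA.
    by rewrite [ltnRHS]rk_before.
  apply: rk_ltn => //; apply/eqP => cA.
  by have := card_core A; rewrite cA; move: A2; clear; lia.
by move=> A rA; rewrite /prv rA; apply: rk_before.
Qed.

(** * The size of the exponent and the final bound *)

Lemma sum_card_sets m : (2 * \sum_(A : {set 'I_m}) #|A| = m * 2 ^ m)%N.
Proof.
rewrite mul2n -addnn [X in (X + _)%N](reindex_inj (@setC_inj _)) -big_split /=.
under eq_bigr => A _ do rewrite addnC cardsC card_ord.
by rewrite sum_nat_const mulnC -cardsT -powersetT card_powerset cardsT card_ord.
Qed.

Lemma walsh_le m (A : {set 'I_m}) n : `|walsh A n| <= \sum_x `|n x|.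
Proof.
apply: le_trans (ler_norm_sum _ _ _) _; apply: ler_sum => x _.
by rewrite normrM; case: (chi_cases A x) => ->; rewrite ?normrN normr1 mul1r.
Qed.

Lemma minimal_seq_long (R : realType) m : (6 <= m)%N ->
  exists (t : nat) (v : 'I_t -> 'rV[R]_(2 ^ m)),
    minimal_seq v /\ ((2 ^ m) ^ 2 ^ m <= t ^ 2 * (2 ^ 12) ^ 2 ^ m)%N.
Proof.
case: m => // m m5; have [W] := walk_exists m5.
have cT : #|{set 'I_m.+1}| = (2 ^ m.+1)%N.
  by rewrite -cardsT -powersetT card_powerset cardsT card_ord.
have [a aF aC] : exists2 a, a \in base W & a \notin core W (base W).
  apply/subsetPn; apply/negP => /subset_leq_card; rewrite card_core.
  by have := card_base W; clear; lia.
have [n [sn zn]] := solves_exists aF aC.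
have rT := rank_sub W (subsetT (base W)).
have [z16 _ zT] := walsh_growth aF sn zn rT.
have zn1 := le_trans zT (walsh_le _ _).
have [t [v [vmin tn]]] : exists (t : nat) (v : 'I_t -> 'rV[R]_(2 ^ m.+1)),
    minimal_seq v /\ \sum_x `|n x| <= t%:Z.
  apply: (@minimal_seq_of_relation R _ _ _ (gate W) (driver W a)) => //.
  - by move=> A x; case: (gate_cases W A x) => ->; rewrite ?normrN normr1.
  - by move=> A; case: (driver_cases W a A) => [|[|]] ->.
  - move=> A; rewrite -/(rowsum W A n); have [+ _] := sn A.
    by case: (driver_cases W a A) => [|[|]] -> [] ->.
  - case: (pickP (fun x => n x != 0)) => [x nx | n0]; first by exists x.
    move: z16; rewrite /walsh big1 // => x _.
    by have /negbT/negPn/eqP -> := n0 x; rewrite mulr0.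
  - move=> n' bn'; have [n0 | [e [x [e1 n'E]]]] := rowsum_bounded1 (W := W) bn'.
      by rewrite big1 // => x _; rewrite n0.
    rewrite (bigD1 x) //= big1 ?n'E /unit_at ?eqxx ?mulr1 ?addr0 => [|y /negbTE nyx].
      by case: e1 => ->.
    by rewrite n'E /unit_at nyx mulr0.
  by move=> n'; apply: (solves_unique (n := n) aF aC sn).
exists t, v; split=> //.
set E := (\sum_(B | _) _)%N in zT zn1.
have tE : (2 ^ E <= t)%N by have := le_trans zn1 tn; rewrite -natrX natz lez_nat.
(* Each set contributes to [E] at least its size minus 6; doubling this loss gives the 12, hence the
   factor [2 ^ 12]. *)
have EE : (m.+1 * 2 ^ m.+1 <= E * 2 + 12 * 2 ^ m.+1)%N.
  rewrite -sum_card_sets mulnC (_ : 12 * _ = 6 * 2 ^ m.+1 * 2)%N; last by rewrite mulnAC.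
  rewrite -mulnDl leq_mul2r /=.
  rewrite -cT mulnC -sum_nat_const /E [X in (_ <= X + _)%N]big_mkcond -big_split /=.
  apply: leq_sum => A _; have := large_rank W A.
  rewrite (rank_sub W (subsetT A)) andbT => <-.
  case: ifP => [_ | /negbT]; first by rewrite addnC -leq_subLR leq_sub2l.
  by rewrite -leqNgt => /leqW.
rewrite -!expnM (leq_trans (leq_pexp2l _ EE)) // expnD leq_mul //.
by rewrite expnM leq_exp2r.
Qed.

Theorem theorem2 (R : realType) :
  exists c : R, 0 < c /\
    forall k : nat,
      exists (t : nat) (v : 'I_t -> 'rV[R]_(2 ^ k)),
        minimal_seq v /\
        Num.sqrt ((c * (2 ^ k)%:R) ^+ (2 ^ k)) <= t%:R.
Proof.
exists (2 ^ 12)%:R^-1; split; first by rewrite invr_gt0 ltr0n expn_gt0.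
move=> k; have [k6 | k6] := ltnP k 6.
  (* For [k < 6] the bound is at most 1, and two zero vectors form a minimal sequence, since no [S]
     satisfies [2 <= #|S| < 2]. *)
  exists 2, (fun=> 0); split.
    split=> //; split; [|split].
    - by move=> i j; rewrite mxE normr0.
    - by move=> j; rewrite big1 // mxE normr0.
    by move=> S S2; rewrite ltnNge S2.
  apply: (@le_trans _ _ 1); last by rewrite ler1n.
  rewrite -[leRHS]sqrtr1 ler_wsqrtr // exprn_ile1 // mulrC ?divr_ge0 ?ler0n //.
  by rewrite ler_pdivrMr ?mul1r ?ler_nat ?leq_exp2l ?ltr0n ?expn_gt0 // (leq_trans (ltnW k6)).
have [t [v [vmin tE]]] := minimal_seq_long R k6; exists t, v; split=> //.
rewrite -[leRHS]ger0_norm ?ler0n // -sqrtr_sqr ler_wsqrtr // mulrC expr_div_n.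
rewrite ler_pdivrMr ?exprn_gt0 ?ltr0n ?expn_gt0 //.
by rewrite -!natrX -natrM ler_nat.
Qed.
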